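(* Blink (as defined in the context) satisfies Termination: in every execution, every correct server eventually triggers $\langle con.\mathrm{Decide}\rangle$.
   Context: **Model.** $f\ge 0$ is an integer; $\Pi$ is a fixed, commonly known set of $n=5f+1$ servers, of which at most $f$ are faulty (Byzantine: may behave arbitrarily and collude); the others are correct and follow the algorithm. Any two servers (including a server and itself) communicate via reliable, authenticated, FIFO links, with message delays bounded by an unknown constant $\Delta$. Event handlers execute atomically. $\mathbb B=\{\mathtt{True},\mathtt{False}\}$. **Binary Consensus** (instance $dep$): every correct server proposes one value via $\langle dep.\mathrm{Propose}\mid p\rangle$, $p\in\mathbb B$, and may trigger $\langle dep.\mathrm{Decide}\mid d\rangle$, $d\in\mathbb B$. Integrity: no correct server decides more than once. Agreement: no two correct servers decide different values. Termination: if every correct server proposes, every correct server eventually decides. Validity: a decided value was proposed by at least one correct server. **Blink** (instance $con$, built on one Binary Consensus instance $dep$). Every correct server triggers $\langle con.\mathrm{Propose}\mid\cdot\rangle$ exactly once. Each server keeps a map $suggestions$ from $\Pi$ to $\mathbb B$ (initially empty) and flags $proposed=decided=\mathtt{False}$. (i) Upon $\langle con.\mathrm{Propose}\mid v\rangle$: send $[\mathtt{Suggest},v]$ to every server. (ii) Upon delivering $[\mathtt{Suggest},v]$ from $\sigma\in\Pi$: set $suggestions[\sigma]=v$. (iii) Upon $|suggestions|\ge 4f+1$ (number of keys) and $proposed=\mathtt{False}$: pick $v$ with $|\{\pi: suggestions[\pi]=v\}|\ge 2f+1$, trigger $\langle dep.\mathrm{Propose}\mid v\rangle$, set $proposed=\mathtt{True}$.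 (iv) Upon existence of $v$ with $|\{\pi: suggestions[\pi]=v\}|\ge 4f+1$: if $decided=\mathtt{False}$, trigger $\langle con.\mathrm{Decide}\mid v\rangle$ and set $decided=\mathtt{True}$. (v) Upon $\langle dep.\mathrm{Decide}\mid v\rangle$: if $decided=\mathtt{False}$, trigger $\langle con.\mathrm{Decide}\mid v\rangle$ and set $decided=\mathtt{True}$. *)

(* Defs.v *)
From mathcomp Require Import all_boot all_order all_algebra.

Set Implicit Arguments.
Unset Strict Implicit.
Unset Printing Implicit Defensive.

Import Order.TTheory GRing.Theory Num.Theory.
Local Open Scope nat_scope.

(** ** Binary Consensus, as seen at its interface

    [propose p v i] (resp. [decide p v i]): server [p] triggers Propose (resp.
    receives Decide) with value [v] at step [i] of the execution. *)

Definition at_most_once (Pi : finType) (correct : {set Pi})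
    (ev : Pi -> bool -> nat -> Prop) : Prop :=
  forall p v w i j, p \in correct -> ev p v i -> ev p w j -> i = j /\ v = w.

Definition at_least_once (Pi : finType) (correct : {set Pi})
    (ev : Pi -> bool -> nat -> Prop) : Prop :=
  forall p, p \in correct -> exists v i, ev p v i.

Definition agreement (Pi : finType) (correct : {set Pi})
    (decide : Pi -> bool -> nat -> Prop) : Prop :=
  forall p q v w i j, p \in correct -> q \in correct ->
    decide p v i -> decide q w j -> v = w.

Definition validity (Pi : finType) (correct : {set Pi})
    (propose decide : Pi -> bool -> nat -> Prop) : Prop :=
  forall p v i, p \in correct -> decide p v i ->
    exists q j, [/\ q \in correct, j < i & propose q v j].

(** The guarantees hold only if the instance is used as intended, i.e. if no
    correct server proposes twice; its users have to ensure this. *)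
Definition binary_consensus (Pi : finType) (correct : {set Pi})
    (propose decide : Pi -> bool -> nat -> Prop) : Prop :=
  at_most_once correct propose ->
  [/\ at_most_once correct decide,
      agreement correct decide,
      at_least_once correct propose -> at_least_once correct decide
    & validity correct propose decide].

(** ** Local state of a server running Blink *)

(** [Other] stands for whatever a faulty server may send that is not a
    well-formed [Suggest] message; no handler of Blink matches it. *)
Variant message := Suggest of bool | Other.

Record lstate (Pi : finType) := LState {
  suggestions : {ffun Pi -> option bool};
  proposed : bool;
  decided : bool
}.

Definition init_lstate (Pi : finType) : lstate Pi :=
  LState [ffun => None] false false.

Definition keys (Pi : finType) (st : lstate Pi) : {set Pi} :=
  [set s | suggestions st s != None].

Definition supporters (Pi : finType) (st : lstate Pi) (v : bool) : {set Pi} :=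
  [set s | suggestions st s == Some v].

Definition on_message (Pi : finType) (s : Pi) (m : message) (st : lstate Pi) :
    lstate Pi :=
  if m is Suggest v then
    LState [ffun s' => if s' == s then Some v else suggestions st s']
      (proposed st) (decided st)
  else st.

Definition set_proposed (Pi : finType) (st : lstate Pi) : lstate Pi :=
  LState (suggestions st) true (decided st).

Definition set_decided (Pi : finType) (st : lstate Pi) : lstate Pi :=
  LState (suggestions st) (proposed st) true.

(** ** Global configurations *)

(** [sent c (s, p)] is the sequence of all messages sent so far on the link from
    [s] to [p], oldest first; the first [rcvd c (s, p)] of them have been
    delivered. [local c p] is meaningful only for correct [p]. *)
Record config (Pi : finType) := Config {
  local : {ffun Pi -> lstate Pi};
  sent : {ffun Pi * Pi -> seq message};
  rcvd : {ffun Pi * Pi -> nat}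
}.

Definition init_config (Pi : finType) : config Pi :=
  Config [ffun => init_lstate Pi] [ffun => [::]] [ffun => 0].

Definition update_local (Pi : finType) (p : Pi) (h : lstate Pi -> lstate Pi)
    (c : config Pi) : config Pi :=
  Config [ffun q => if q == p then h (local c q) else local c q]
    (sent c) (rcvd c).

Definition send_to (Pi : finType) (s : Pi) (dest : {set Pi}) (m : message)
    (c : config Pi) : config Pi :=
  Config (local c)
    [ffun e => if (e.1 == s) && (e.2 \in dest) then rcons (sent c e) m
               else sent c e]
    (rcvd c).

Definition incr_rcvd (Pi : finType) (s p : Pi) (c : config Pi) : config Pi :=
  Config (local c) (sent c)
    [ffun e => if e == (s, p) then (rcvd c e).+1 else rcvd c e].

(** ** Steps

    Each step is one atomic event; [output] is the interface event, if any, that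
    a correct server triggers while handling it. *)
Variant event (Pi : finType) :=
  | ConPropose of Pi & bool
  | Deliver of Pi & Pi & message      (* sender, receiver, message *)
  | ProposeGuard of Pi                (* handler with guard on the number of keys *)
  | DecideGuard of Pi                 (* handler with guard on supporters of a value *)
  | DepDecide of Pi & bool
  | FaultySend of Pi & Pi & message   (* sender, receiver, message *)
  | Idle.
Arguments Idle {Pi}.

Variant output (Pi : finType) :=
  | Silent
  | DepPropose of Pi & bool
  | ConDecide of Pi & bool.
Arguments Silent {Pi}.

Definition decide_output (Pi : finType) (c : config Pi) (p : Pi) (v : bool) :
    output Pi :=
  if decided (local c p) then Silent else ConDecide p v.

Variant step (Pi : finType) (f : nat) (faulty : {set Pi}) (c : config Pi) :
    event Pi -> output Pi -> config Pi -> Prop :=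
  | StepConPropose p v of p \notin faulty :
      step f faulty c (ConPropose p v) Silent
        (send_to p [set: Pi] (Suggest v) c)
  | StepDeliver s p m of onth (sent c (s, p)) (rcvd c (s, p)) = Some m :
      step f faulty c (Deliver s p m) Silent
        (update_local p (on_message s m) (incr_rcvd s p c))
  | StepProposeGuard p v of
        p \notin faulty
      & 4 * f + 1 <= #|keys (local c p)|
      & ~~ proposed (local c p)
      & 2 * f + 1 <= #|supporters (local c p) v| :
      step f faulty c (ProposeGuard p) (DepPropose p v)
        (update_local p (@set_proposed Pi) c)
  | StepDecideGuard p v of
        p \notin faulty
      & 4 * f + 1 <= #|supporters (local c p) v| :
      step f faulty c (DecideGuard p) (decide_output c p v)
        (update_local p (@set_decided Pi) c)
  | StepDepDecide p v of p \notin faulty :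
      step f faulty c (DepDecide p v) (decide_output c p v)
        (update_local p (@set_decided Pi) c)
  | StepFaultySend s p m of s \in faulty :
      step f faulty c (FaultySend s p m) Silent (send_to s [set p] m c)
  | StepIdle :
      step f faulty c Idle Silent c.

(** ** Executions *)

(** Step [i] occurs at real time [time x i], leads from [conf x i] to
    [conf x i.+1], and consists of the event [evt x i] with output [out x i].
    [Idle] steps allow infinite sequences to represent finite executions. *)
Record trace (R : realFieldType) (Pi : finType) := Trace {
  conf : nat -> config Pi;
  evt : nat -> event Pi;
  out : nat -> output Pi;
  time : nat -> R
}.

Definition con_proposes (R : realFieldType) (Pi : finType) (x : trace R Pi)
    (p : Pi) (v : bool) (i : nat) : Prop := evt x i = ConPropose p v.

Definition con_decides (R : realFieldType) (Pi : finType) (x : trace R Pi)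
    (p : Pi) (v : bool) (i : nat) : Prop := out x i = ConDecide p v.

Definition dep_proposes (R : realFieldType) (Pi : finType) (x : trace R Pi)
    (p : Pi) (v : bool) (i : nat) : Prop := out x i = DepPropose p v.

Definition dep_decides (R : realFieldType) (Pi : finType) (x : trace R Pi)
    (p : Pi) (v : bool) (i : nat) : Prop := evt x i = DepDecide p v.

(** Reliability with bounded delay: a message sent by step [i] is delivered
    within time [Delta] of step [i]. *)
Definition bounded_delay (R : realFieldType) (Pi : finType) (x : trace R Pi)
    (Delta : R) : Prop :=
  forall (e : Pi * Pi) (k i : nat), k < size (sent (conf x i.+1) e) ->
  exists2 j, (time x j <= time x i + Delta)%R & k < rcvd (conf x j.+1) e.

(** The last conjunct says that a suitable value can be picked. It is not assumed
    to follow from the guard: fairness does not force a handler that cannot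
    execute. *)
Definition propose_ready (Pi : finType) (f : nat) (st : lstate Pi) : Prop :=
  [/\ 4 * f + 1 <= #|keys st|, ~~ proposed st
    & exists v, 2 * f + 1 <= #|supporters st v|].

(** Once [decided] is set the handler has no effect, hence need not run again. *)
Definition decide_ready (Pi : finType) (f : nat) (st : lstate Pi) : Prop :=
  ~~ decided st /\ exists v, 4 * f + 1 <= #|supporters st v|.

(** A guarded handler of [p] that stays ready forever eventually runs. *)
Definition weakly_fair (R : realFieldType) (Pi : finType) (x : trace R Pi)
    (p : Pi) (ready : lstate Pi -> Prop) (e : event Pi) : Prop :=
  forall i, (forall j, i <= j -> ready (local (conf x j) p)) ->
  exists2 j, i <= j & evt x j = e.

Record blink_execution (R : realFieldType) (Pi : finType) (f : nat)
    (faulty : {set Pi}) (x : trace R Pi) : Prop := BlinkExecution {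
  exec_init : conf x 0 = init_config Pi;
  exec_step : forall i,
    step f faulty (conf x i) (evt x i) (out x i) (conf x i.+1);
  exec_time : forall i j, i <= j -> (time x i <= time x j)%R;
  exec_delay : exists Delta : R, bounded_delay x Delta;
  exec_fair_propose : forall p, p \notin faulty ->
    weakly_fair x p (propose_ready f) (ProposeGuard p);
  exec_fair_decide : forall p, p \notin faulty ->
    weakly_fair x p (decide_ready f) (DecideGuard p);
  exec_dep : binary_consensus (~: faulty) (dep_proposes x) (dep_decides x);
  exec_con_propose : at_least_once (~: faulty) (con_proposes x);
  exec_con_propose_once : at_most_once (~: faulty) (con_proposes x)
}.

(* Main.v *)
(** Every correct server sends a suggestion to every server, so that each
    correct server [p] eventually holds at least [4f + 1] suggestions, for good.
    They take two values only, hence one of these has at least [2f + 1]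
    supporters: were [p] never to propose to the consensus instance, its
    proposal handler would stay ready forever, contradicting fairness. The flag
    [proposed] excludes double proposals, so the guarantees of the consensus
    instance apply and [p] receives a decision. At that moment [p] decides,
    unless it has done so before. *)
Require Import Defs.
From mathcomp Require Import all_boot all_order all_algebra.
From mathcomp Require Import zify.
From Stdlib Require Import Classical.

Set Implicit Arguments.
Unset Strict Implicit.
Unset Printing Implicit Defensive.

Local Open Scope nat_scope.

Lemma onth_rcons (T : Type) (s : seq T) (y : T) (k : nat) (m : T) :
  onth s k = Some m -> onth (rcons s y) k = Some m.
Proof. by elim: s k => [|z s IHs] [|k] //=; apply: IHs. Qed.

Lemma onth_rcons_size (T : Type) (s : seq T) (y : T) :
  onth (rcons s y) (size s) = Some y.
Proof. by elim: s. Qed.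

Section Blink.

Variables (R : realFieldType) (Pi : finType) (f : nat) (faulty : {set Pi}).
Implicit Types (c : config Pi) (p s : Pi) (x : trace R Pi).

(** Every recorded suggestion is a Boolean, so each key supports [true] or [false]; this feeds the
    pigeonhole argument. *)
Lemma card_keys (st : lstate Pi) :
  #|keys st| <= #|supporters st true| + #|supporters st false|.
Proof.
apply: leq_trans (leq_card_setU _ _); apply/subset_leq_card/subsetP => s.
by rewrite !inE; case: (suggestions st s) => [[]|].
Qed.

Lemma keys_on_message s m (st : lstate Pi) :
  keys st \subset keys (on_message s m st).
Proof.
case: m => [v|]; last by [].
by apply/subsetP => s'; rewrite !inE ffunE; case: ifP.
Qed.

Section Step.

Variables (c c' : config Pi) (e : event Pi) (o : output Pi).
Hypothesis st : step f faulty c e o c'.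

Lemma step_keys p : keys (local c p) \subset keys (local c' p).
Proof.
case: st => * //=; rewrite ?ffunE //=; case: eqP => // _.
exact: keys_on_message.
Qed.

Lemma step_proposed p : proposed (local c p) -> proposed (local c' p).
Proof.
case: st => [||||||] * //=; rewrite ?ffunE //=; case: eqP => //= _.
by case: (X in on_message _ X).
Qed.

Lemma step_sent (l : Pi * Pi) k m :
  onth (sent c l) k = Some m -> onth (sent c' l) k = Some m.
Proof.
by case: st => //= *; rewrite ffunE; case: ifP => // _; apply: onth_rcons.
Qed.

(** Only the proposal handler has this output: its guard needs the flag clear, its body sets it. *)
Lemma step_dep_propose p v : o = DepPropose p v ->
  ~~ proposed (local c p) && proposed (local c' p).
Proof.
case: st => [||q w _ _ npr _ [<- _]|q w _ _|q w _||] //=.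
- by rewrite npr ffunE eqxx.
- by rewrite /decide_output; case: ifP.
- by rewrite /decide_output; case: ifP.
Qed.

Lemma step_decided p : decided (local c' p) ->
  decided (local c p) \/ exists v, o = ConDecide p v.
Proof.
case: st => [q v _|s q m _|q v _ _ _ _|q v _ _|q v _|s q m _|] /=;
  rewrite ?ffunE; try by left.
- by case: eqP => // _; case: m => [w|]; left.
- by case: eqP => // _; left.
- rewrite /decide_output; case: eqP => [->|]; last by left.
  by case: ifP; [left | right; exists v].
- rewrite /decide_output; case: eqP => [->|]; last by left.
  by case: ifP; [left | right; exists v].
Qed.

End Step.

Lemma step_dep_decide c p v o c' :
  step f faulty c (DepDecide p v) o c' -> o = decide_output c p v.
Proof. by move=> st; inversion st. Qed.

(** Invariant tying link counters to local states. The key is claimed for [Suggest] only, since a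
    faulty [s] may send [Other]. *)
Definition deliveries_recorded c := forall s p k, k < rcvd c (s, p) ->
  exists2 m, onth (sent c (s, p)) k = Some m
           & forall v, m = Suggest v -> s \in keys (local c p).

Lemma step_deliveries_recorded c e o c' : step f faulty c e o c' ->
  deliveries_recorded c -> deliveries_recorded c'.
Proof.
move=> st rec s p k.
have old : k < rcvd c (s, p) -> exists2 m, onth (sent c' (s, p)) k = Some m
           & forall v, m = Suggest v -> s \in keys (local c' p).
  move=> /rec[m sm key]; exists m; first exact: step_sent st _ _ _ sm.
  by move=> v /key; apply: (subsetP (step_keys st p)).
case: st old => //= s' p' m sm old; rewrite [X in k < X]ffunE.
case: eqP => [[? ?]|_] //; subst s' p'.
(* The only new slot is the one just consumed, at the old value of the counter. *)
rewrite ltnS leq_eqVlt => /orP[/eqP ->|]; last exact: old.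
by exists m => // v ->; rewrite inE ffunE eqxx /= ffunE eqxx.
Qed.

Section Execution.

Variable x : trace R Pi.
Hypothesis exec_x : blink_execution f faulty x.

Lemma exec_ind (P : config Pi -> Prop) i j :
    (forall c e o c', step f faulty c e o c' -> P c -> P c') ->
  i <= j -> P (conf x i) -> P (conf x j).
Proof.
move=> stepP; elim: j => [|j IHj]; first by rewrite leqn0 => /eqP ->.
rewrite leq_eqVlt => /orP[/eqP -> //|/IHj{}IHj /IHj].
exact: stepP (exec_step exec_x j).
Qed.

Lemma exec_deliveries_recorded i : deliveries_recorded (conf x i).
Proof.
apply: (@exec_ind deliveries_recorded 0) => //.
  by move=> c e o c' /step_deliveries_recorded.
by rewrite (exec_init exec_x) => s p k; rewrite ffunE.
Qed.

(** Links are append-only, so the suggestion of [s] keeps its slot; bounded delay moves the counter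
    past that slot, and the invariant then yields the key. *)
Lemma exec_key s p : s \notin faulty ->
  exists i, forall j, i <= j -> s \in keys (local (conf x j) p).
Proof.
move=> ns; have [|v [i evi]] := @exec_con_propose _ _ _ _ _ exec_x s.
  by rewrite inE.
have [Delta delay] := exec_delay exec_x.
set k := size (sent (conf x i) (s, p)).
have sv : onth (sent (conf x i.+1) (s, p)) k = Some (Suggest v).
  move: (exec_step exec_x i); rewrite evi; set c' := conf x i.+1 => st.
  inversion st; subst.
  by rewrite /= ffunE /= eqxx inE onth_rcons_size.
have lt_k : k < size (sent (conf x i.+1) (s, p)).
  by rewrite -onthTE sv.
have [j _ kj] := delay _ _ _ lt_k.
exists (maxn i.+1 j.+1) => j'; rewrite geq_max => /andP[ij jj'].
apply: (@exec_ind (fun c => s \in keys (local c p)) (maxn i.+1 j.+1)).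
- by move=> c e o c' st; apply: (subsetP (step_keys st p)).
- by rewrite geq_max ij.
have rc : k < rcvd (conf x (maxn i.+1 j.+1)) (s, p).
  apply: (@exec_ind (fun c => k < rcvd c (s, p)) j.+1) kj; last exact: leq_maxr.
  move=> c e o c' [] //= *; rewrite ffunE; case: ifP => // _; exact: ltnW.
(* The message [m] in slot [k] is still the suggestion sent at step [i]. *)
have [m sm] := exec_deliveries_recorded rc.
apply; apply: Some_inj; rewrite -sm.
apply: (@exec_ind (fun c => onth (sent c (s, p)) k = Some (Suggest v)) i.+1) sv.
- by move=> c e o c' st; apply: step_sent st _ _ _.
- exact: leq_maxl.
Qed.

Lemma exec_keys p :
  exists i, forall j, i <= j -> ~: faulty \subset keys (local (conf x j) p).
Proof.
(* Correctness of [s] is moved inside so that a threshold exists for every server; faulty ones get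
   0. *)
have /fin_all_exists[t tP] : forall s, exists i, forall j, i <= j ->
    s \notin faulty -> s \in keys (local (conf x j) p).
  move=> s; case: (boolP (s \in faulty)) => [_|/(exec_key p)[i iP]].
    by exists 0.
  by exists i => j /iP.
exists (\max_s t s) => j le_j; apply/subsetP => s; rewrite inE.
by apply: tP; apply: leq_trans (leq_bigmax s) le_j.
Qed.

Lemma dep_proposes_once : at_most_once (~: faulty) (dep_proposes x).
Proof.
(* If [i < j], the flag set by step [i] would persist to step [j], which needs it clear. Symmetry
   gives [i = j]. *)
have le p v w i j : dep_proposes x p v i -> dep_proposes x p w j -> j <= i.
  move=> /(step_dep_propose (exec_step exec_x i))/andP[_ pi].
  move=> /(step_dep_propose (exec_step exec_x j))/andP[npj _].
  rewrite leqNgt; apply: contra npj => ij.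
  apply: (@exec_ind (fun c => proposed (local c p)) i.+1) pi => //.
  by move=> c e o c' /step_proposed; apply.
move=> p v w i j _ pi pj.
have ij : i = j by apply/eqP; rewrite eqn_leq (le _ _ _ _ _ pi pj)
    (le _ _ _ _ _ pj pi).
by split=> //; move: pi pj; rewrite /dep_proposes ij => -> [].
Qed.

Lemma exec_decided p i :
  decided (local (conf x i) p) -> exists d j, con_decides x p d j.
Proof.
elim: i => [|i IHi]; first by rewrite (exec_init exec_x) ffunE.
by move=> /(step_decided (exec_step exec_x i))[/IHi|[v ov]] //; exists v, i.
Qed.

Lemma dep_proposes_at_least_once :
  4 * f + 1 <= #|~: faulty| -> at_least_once (~: faulty) (dep_proposes x).
Proof.
move=> many p; rewrite inE => np; apply: NNPP => never.
have npr i : ~~ proposed (local (conf x i) p).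
  elim: i => [|i IHi]; first by rewrite (exec_init exec_x) ffunE.
  move: (exec_step exec_x i) never IHi.
  set c' := conf x i.+1 => st never; inversion st; subst => //=;
    rewrite ?ffunE //; case: eqP => // pq; rewrite /=.
  - by case: (m).
  - by case: never; exists v, i; rewrite /dep_proposes pq.
have [t tP] := exec_keys p.
have [j tj|j _ evj] := @exec_fair_propose _ _ _ _ _ exec_x p np t.
  have le_keys := leq_trans many (subset_leq_card (tP j tj)).
  split=> //; have le_sup := leq_trans le_keys (card_keys _).
  case: (leqP (2 * f + 1) #|supporters (local (conf x j) p) true|) => [|lt].
    by exists true.
  (* Otherwise both values would have at most [2 * f] supporters, hence at most [4 * f] keys. *)
  by exists false; lia.
move: (exec_step exec_x j); rewrite evj => st; inversion st; subst.
by apply: never; exists v, j.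
Qed.

End Execution.

End Blink.

Theorem theorem1 (R : realFieldType) (f : nat) (Pi : finType)
    (card_Pi : #|Pi| = (5 * f + 1)%N)
    (faulty : {set Pi}) (card_faulty : (#|faulty| <= f)%N)
    (x : trace R Pi) (exec_x : blink_execution f faulty x)
    (p : Pi) (correct_p : p \notin faulty) :
  exists (d : bool) (i : nat), con_decides x p d i.
Proof.
have many : 4 * f + 1 <= #|~: faulty| by have := cardsC faulty; lia.
have [_ _ decides _] := exec_dep exec_x (dep_proposes_once exec_x).
have [|v [i evi]] := decides (dep_proposes_at_least_once exec_x many) p.
  by rewrite inE.
move: (exec_step exec_x i); rewrite evi => /step_dep_decide o_i.
(* With the flag already set this step is silent, but an earlier step made the decision. *)
case dec: (decided (local (conf x i) p)).
  exact (exec_decided exec_x dec).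
by exists v, i; rewrite /con_decides o_i /decide_output dec.
Qed.
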